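(* For any positive integers $q$ and $n$, in the cell-probe model with $w$ bits per cell there exist instances of the online convolution problem (over $\mathbb{Z}/q\mathbb{Z}$) such that the expected amortised time (number of cell probes) per $\mathrm{next}$-operation of any algorithm solving the problem is $\Omega\left(\frac{\delta}{w}\log n\right)$, where $\delta=\log_2 q$.
   Context: Notation: $[q]=\{0,\dots,q-1\}$. Online convolution problem with parameters $n,q$ and a fixed vector $V\in[q]^n$: maintain a vector $A\in[q]^n$ (initially all zeros) under the operation $\mathrm{next}(\Delta)$, $\Delta\in[q]$, which replaces $A$ by $(A[1],A[2],\dots,A[n-1],\Delta)$ and then returns the inner product $\langle A,V\rangle=\sum_{i\in[n]}A[i]V[i]$ modulo $q$. Each answer must be returned before the next input arrives. Cell-probe model: memory consists of cells of $w$ bits each (each cell can hold the address of any cell); computation is free and the algorithm keeps no state between operations other than the memory; cost is the number of cell reads and writes. An ''instance'' consists of a choice of the vector $V$ together with a probability distribution over the input sequence of $\mathrm{next}$-operations; the bound is on the expected cost. *)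

(* Defs.v *)
From HB Require Import structures.
From mathcomp Require Import all_boot all_order all_algebra.
From mathcomp Require Import all_classical all_reals all_analysis.

Set Implicit Arguments.
Unset Strict Implicit.
Unset Printing Implicit Defensive.

Import Order.TTheory GRing.Theory Num.Theory.

Local Open Scope ring_scope.

Section Convolution.
Variables (q n : nat).
Implicit Types A V : n.-tuple 'I_q.

Definition shift A (x : 'I_q) : n.-tuple 'I_q := [tuple of behead (rcons A x)].

Definition inner_mod A V : nat :=
  ((\sum_(i < n) tnth A i * tnth V i) %% q)%N.

Definition zero_vector (q_gt0 : (0 < q)%N) : n.-tuple 'I_q :=
  nseq_tuple n (Ordinal q_gt0).

Fixpoint answers V A (xs : seq 'I_q) : seq nat :=
  if xs is x :: xs' then inner_mod (shift A x) V :: answers V (shift A x) xs'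
  else [::].

End Convolution.

(* Cell-probe model: both cell contents and cell addresses are [w]-bit words, so that a cell can
   hold the address of any cell. *)
Definition word (w : nat) := w.-tuple bool.

Definition memory (w : nat) := {ffun word w -> word w}.

(* The computation carried out during one operation: an adaptive sequence of
   probes ending with an answer. Each continuation is an arbitrary function of
   what has been read so far, as computation is free. *)
Inductive probing (q w : nat) : Type :=
  | Return of 'I_q
  | Read of word w & (word w -> probing q w)
  | Write of word w & word w & probing q w.

Fixpoint result q w (p : probing q w) (mem : memory w) : 'I_q :=
  match p with
  | Return y => y
  | Read a k => result (k (mem a)) mem
  | Write a v p' => result p' [ffun b => if b == a then v else mem b]
  end.

Fixpoint final_memory q w (p : probing q w) (mem : memory w) : memory w :=
  match p with
  | Return _ => mem
  | Read a k => final_memory (k (mem a)) mem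
  | Write a v p' => final_memory p' [ffun b => if b == a then v else mem b]
  end.

Fixpoint probe_count q w (p : probing q w) (mem : memory w) : nat :=
  match p with
  | Return _ => 0
  | Read a k => (probe_count (k (mem a)) mem).+1
  | Write a v p' => (probe_count p' [ffun b => if b == a then v else mem b]).+1
  end.

(* What [next x] does depends only on [x] and on the memory. The initial memory
   is arbitrary: preprocessing is free. *)
Record algorithm (q w : nat) := Algorithm {
  initial_memory : memory w;
  next : 'I_q -> probing q w
}.

Section Execution.
Variables (q w : nat) (alg : algorithm q w).

Fixpoint outputs_from (mem : memory w) (xs : seq 'I_q) : seq 'I_q :=
  if xs is x :: xs' then
    result (next alg x) mem :: outputs_from (final_memory (next alg x) mem) xs'
  else [::].

Fixpoint cost_from (mem : memory w) (xs : seq 'I_q) : nat :=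
  if xs is x :: xs' then
    (probe_count (next alg x) mem + cost_from (final_memory (next alg x) mem) xs')%N
  else 0%N.

Definition outputs := outputs_from (initial_memory alg).

Definition total_cost := cost_from (initial_memory alg).

End Execution.

Definition solves q n w (q_gt0 : (0 < q)%N) (V : n.-tuple 'I_q)
    (alg : algorithm q w) : Prop :=
  forall xs : seq 'I_q,
    map val (outputs alg xs) = answers V (zero_vector n q_gt0) xs.

Record instance (R : realType) (q n : nat) := Instance {
  inst_vector : n.-tuple 'I_q;
  inst_length : nat;
  inst_length_gt0 : (0 < inst_length)%N;
  inst_prob : {ffun inst_length.-tuple 'I_q -> R};
  inst_prob_ge0 : forall xs, 0 <= inst_prob xs;
  inst_prob_sum1 : \sum_xs inst_prob xs = 1
}.

(* An algorithm that may toss coins is a family of deterministic algorithms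
   indexed by the outcomes of a probability space; a deterministic one is a
   constant family. *)
Definition random_algorithm d (T : measurableType d) (q w : nat) :=
  T -> algorithm q w.

Definition solves_surely d (T : measurableType d) q n w (q_gt0 : (0 < q)%N)
    (V : n.-tuple 'I_q) (alg : random_algorithm T q w) : Prop :=
  forall t, solves q_gt0 V (alg t).

Definition measurable_cost (R : realType) d (T : measurableType d) q w
    (alg : random_algorithm T q w) : Prop :=
  forall xs : seq 'I_q,
    measurable_fun setT (fun t => (total_cost (alg t) xs)%:R : R).

Definition expected_amortised_cost (R : realType) d (T : measurableType d)
    (P : probability T R) q n w (I : instance R q n)
    (alg : random_algorithm T q w) : \bar R :=
  (\int[P]_t (\sum_xs inst_prob I xs *
     ((total_cost (alg t) xs)%:R / (inst_length I)%:R))%:E)%E.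

Definition log2 (R : realType) (x : R) : R := ln x / ln 2.

(* Main.v *)
Require Import Defs.
From mathcomp Require Import all_boot all_order all_algebra.
From mathcomp Require Import all_classical all_reals all_analysis.
From mathcomp Require Import measurable_realfun zify ring lra.

(** Information transfer.  Take [V] with entry 1 at the distances from the end
    that are powers of two, and [2 ^ K <= n] uniform inputs.  Cut time along a
    balanced binary tree; at a node whose two halves have length [2 ^ k], the
    answers in the second half determine the inputs of the first, so the cells
    changed in the first half and read in the second before being overwritten
    must carry [2 ^ k * log q] bits.  Since such a cell costs [2 * w] bits to
    describe (address and content), there are on average
    [2 ^ k * log q / (4 * w)] of them, and each level of the tree contributes
    the same amount.  A read is charged to at most one node, namely the one
    separating it from the last write to the same cell. *)

Set Implicit Arguments.
Unset Strict Implicit.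
Unset Printing Implicit Defensive.

Lemma card_word w : #|{: word w}| = 2 ^ w.
Proof. by rewrite card_tuple card_bool. Qed.

(** * Cells read before being overwritten, and transfer between time intervals *)

Section FirstReads.
Variables (q w : nat).

(** The cells on whose initial content the operation depends: a cell written before it is read is
    left out. *)
Fixpoint probing_first_reads (p : probing q w) (mem : memory w) : {set word w} :=
  match p with
  | Return _ => finset.set0
  | Read a k => a |: probing_first_reads (k (mem a)) mem
  | Write a v p' =>
      probing_first_reads p' [ffun b => if b == a then v else mem b] :\ a
  end.

Lemma card_probing_first_reads (p : probing q w) mem :
  #|probing_first_reads p mem| <= probe_count p mem.
Proof.
elim: p mem => [y|a k IH|a v p IH] mem /=; first by rewrite cards0.
  by apply: leq_trans (leq_card_setU _ _) _; rewrite cards1 add1n ltnS.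
by apply: leq_trans (subset_leq_card (subsetDl _ _)) _; apply/leqW/IH.
Qed.

(** Both runs make the same probes, so every cell is either written alike or left alone by both. The
    second conclusion carries the agreement over to the next operation. *)
Lemma eq_on_probing_first_reads (p : probing q w) (mem mem' : memory w) :
    {in probing_first_reads p mem, mem' =1 mem} ->
  result p mem' = result p mem /\
  forall a, final_memory p mem' a = final_memory p mem a \/
    final_memory p mem' a = mem' a /\ final_memory p mem a = mem a.
Proof.
elim: p mem mem' => [y|a k IH|a v p IH] mem mem' /= eqm.
- by split=> // a; right.
- have eqa : mem' a = mem a by apply: eqm; rewrite !inE eqxx.
  rewrite eqa; apply: IH => b b_in; apply: eqm.
  by rewrite !inE b_in orbT.
have [|-> eqf] := IH [ffun b => if b == a then v else mem b]
                     [ffun b => if b == a then v else mem' b].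
  move=> b b_in; rewrite !ffunE; case: eqVneq => // b_neq.
  by apply: eqm; rewrite !inE b_neq.
split=> // b; case: (eqf b) => [->|[-> ->]]; first by left.
by rewrite !ffunE; case: eqP; [left|right].
Qed.

Variable alg : algorithm q w.

Fixpoint memory_after (mem : memory w) (xs : seq 'I_q) : memory w :=
  if xs is x :: xs' then memory_after (final_memory (Defs.next alg x) mem) xs'
  else mem.

Definition changed (mem mem' : memory w) : {set word w} :=
  [set a | mem' a != mem a]%SET.

(* Cells that an operation overwrites with their former content are deliberately
   not removed: this only enlarges the set, and it makes the definition depend
   on the same [changed] that defines [transfer] below. *)
Fixpoint first_reads (mem : memory w) (xs : seq 'I_q) : {set word w} :=
  if xs is x :: xs' then
    let mem' := final_memory (Defs.next alg x) mem in
    probing_first_reads (Defs.next alg x) mem :|: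
      (first_reads mem' xs' :\: changed mem mem')
  else finset.set0.

Lemma memory_after_cat mem xs ys :
  memory_after mem (xs ++ ys) = memory_after (memory_after mem xs) ys.
Proof. by elim: xs mem => //= x xs IH mem. Qed.

Lemma outputs_from_cat mem xs ys :
  outputs_from alg mem (xs ++ ys) =
  outputs_from alg mem xs ++ outputs_from alg (memory_after mem xs) ys.
Proof. by elim: xs mem => //= x xs IH mem; rewrite IH. Qed.

Lemma cost_from_cat mem xs ys :
  cost_from alg mem (xs ++ ys) =
  cost_from alg mem xs + cost_from alg (memory_after mem xs) ys.
Proof. by elim: xs mem => //= x xs IH mem; rewrite IH addnA. Qed.

Lemma size_outputs_from mem xs : size (outputs_from alg mem xs) = size xs.
Proof. by elim: xs mem => //= x xs IH mem; rewrite IH. Qed.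

Lemma card_first_reads mem xs :
  #|first_reads mem xs| <= cost_from alg mem xs.
Proof.
elim: xs mem => [|x xs IH] mem /=; first by rewrite cards0.
apply: leq_trans (leq_card_setU _ _) (leq_add (card_probing_first_reads _ _) _).
exact: leq_trans (subset_leq_card (subsetDl _ _)) (IH _).
Qed.

Lemma first_reads_cat mem xs ys :
  first_reads mem (xs ++ ys) \subset
    first_reads mem xs :|:
    (first_reads (memory_after mem xs) ys :\:
       changed mem (memory_after mem xs)).
Proof.
elim: xs mem => [|x xs IH] mem /=.
  by apply/fintype.subsetP => a; rewrite !inE eqxx => ->.
apply/fintype.subsetP => a.
rewrite !inE => /orP[-> //|/andP[/negPn/eqP eqa a_in]].
have := fintype.subsetP (IH _) a a_in.
by rewrite !inE eqa eqxx => /orP[->|->]; rewrite ?orbT.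
Qed.

Lemma eq_on_first_reads (mem mem' : memory w) xs :
    {in first_reads mem xs, mem' =1 mem} ->
  outputs_from alg mem' xs = outputs_from alg mem xs.
Proof.
elim: xs mem mem' => //= x xs IH mem mem' eqm.
have [|-> eqf] := @eq_on_probing_first_reads (Defs.next alg x) mem mem'.
  by move=> a a_in; apply: eqm; rewrite !inE a_in.
congr (_ :: _); apply: IH => a a_in.
(* A cell left alone is not in [changed], so a first read of [xs] there is also one of [x :: xs]. *)
case: (eqf a) => [//|[-> eqa]]; rewrite eqa; apply: eqm.
by rewrite !inE a_in eqa eqxx orbT.
Qed.

Definition transfer mem xs ys : {set word w} :=
  first_reads (memory_after mem xs) ys :&: changed mem (memory_after mem xs).

Fixpoint total_transfer k mem (xs : seq 'I_q) : nat :=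
  if k is k'.+1 then
    let l := take (2 ^ k') xs in let r := drop (2 ^ k') xs in
    total_transfer k' mem l + total_transfer k' (memory_after mem l) r +
      #|transfer mem l r|
  else 0.

(* The summand [first_reads] strengthens the induction: a first read of [r] lies
   in the transfer at this node or may be a first read of [l ++ r], not both. *)
Lemma total_transfer_le_cost k mem xs :
  total_transfer k mem xs + #|first_reads mem xs| <= cost_from alg mem xs.
Proof.
elim: k mem xs => [|k IH] mem xs /=; first exact: card_first_reads.
set l := take _ _; set r := drop _ _.
have -> : xs = l ++ r by rewrite cat_take_drop.
rewrite cost_from_cat.
have := IH mem l; have := IH (memory_after mem l) r.
have := subset_leq_card (first_reads_cat mem l r).
have [+ _] := leq_card_setU (first_reads mem l)
  (first_reads (memory_after mem l) r :\: changed mem (memory_after mem l)).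
have := cardsID (changed mem (memory_after mem l))
  (first_reads (memory_after mem l) r).
rewrite -/(transfer mem l r).
move: #|first_reads mem l| #|first_reads mem (l ++ r)| #|transfer mem l r|.
move: #|_ :|: _| #|_ :\: _| #|first_reads _ _| => *; lia.
Qed.

End FirstReads.

(** * Counting memories and splitting input sequences *)

(* A memory in the ball is [mem] overridden by [m] pairs (address, content). *)
Lemma card_hamming_ball w (mem : memory w) m :
  #|[set mem' : memory w | #|changed mem mem'| <= m]%SET| <= 2 ^ (2 * w * m).
Proof.
pose upd (s : seq (word w * word w)) : memory w :=
  [ffun a => if a \in unzip1 s then nth a (unzip2 s) (index a (unzip1 s))
             else mem a].
pose T := (m.-tuple (word w * word w))%type.
apply: (@leq_trans #|[set upd t | t : T]%SET|); last first.
  apply: leq_trans (leq_imset_card _ _) _.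
  by rewrite card_tuple card_prod !card_word -expnD addnn -mul2n -expnM.
apply: subset_leq_card; apply/fintype.subsetP => mem'; rewrite inE => small.
pose A := enum (changed mem mem').
pose a0 : word w := nseq_tuple w false.
(* Padding to exactly [m] pairs is harmless, as the padding also records the content of [mem']. *)
pose l := [seq (a, mem' a) | a <- A ++ nseq (m - size A) a0].
have sz : size l == m.
  by rewrite size_map size_cat size_nseq subnKC // -cardE.
apply/finset.imsetP; exists (Tuple sz) => //; apply/ffunP => a; rewrite ffunE /=.
have -> : unzip1 l = A ++ nseq (m - size A) a0.
  by rewrite /unzip1 -map_comp map_id_in.
have -> : unzip2 l = map mem' (A ++ nseq (m - size A) a0).
  by rewrite /unzip2 -map_comp.
case: ifPn => [a_in|]; last first.
  by rewrite mem_cat negb_or mem_enum inE negbK => /andP[/eqP].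
by rewrite (nth_map a) ?index_mem// nth_index.
Qed.

Lemma big_cat_tuple (q N m n : nat) (F : seq 'I_q -> nat) : N = m + n ->
  \sum_(t : N.-tuple 'I_q) F t =
  \sum_(l : m.-tuple 'I_q) \sum_(r : n.-tuple 'I_q) F (l ++ r).
Proof.
move=> ->; rewrite pair_big /=.
rewrite (reindex (fun p : m.-tuple 'I_q * n.-tuple 'I_q => cat_tuple p.1 p.2)) //.
have sz1 (t : (m + n).-tuple 'I_q) : size (take m t) == m.
  by rewrite size_takel // size_tuple leq_addr.
have sz2 (t : (m + n).-tuple 'I_q) : size (drop m t) == n.
  by rewrite size_drop size_tuple addKn.
exists (fun t => (Tuple (sz1 t), Tuple (sz2 t))) => [[l r] _|t _].
  by congr pair; apply: val_inj; rewrite /= ?take_size_cat ?drop_size_cat ?size_tuple.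
by apply: val_inj; rewrite /= cat_take_drop.
Qed.

(** * The hard vector and the recovery of inputs from answers *)

Section HardVector.
Variables (q n : nat) (q_gt0 : 0 < q).

Definition power_of_two j := j == 2 ^ trunc_log 2 j.

(** The distance of index [i] from the end is [n.-1 - i]; reduction modulo [q] keeps the entries in
    range when [q = 1]. *)
Definition hard_vector : n.-tuple 'I_q :=
  [tuple Ordinal (ltn_pmod (power_of_two (n.-1 - i)) q_gt0) | i < n].

Lemma power_of_two_expn k : power_of_two (2 ^ k).
Proof. by rewrite /power_of_two trunc_expnK. Qed.

Lemma power_of_twoF k j : 2 ^ k < j < 2 ^ k.+1 -> power_of_two j = false.
Proof.
move=> /andP[lt_j j_lt]; apply/negbTE.
by rewrite /power_of_two (@trunc_log_eq 2 k) // ?(ltnW lt_j) // neq_ltn lt_j orbT.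
Qed.

Lemma val_foldl_shift (A : n.-tuple 'I_q) xs :
  foldl (@Defs.shift q n) A xs = drop (size xs) (A ++ xs) :> seq 'I_q.
Proof.
elim: xs A => [|x xs IH] A /=; first by rewrite cats0 drop0.
rewrite IH /= -cat_rcons.
case: (rcons _ _) (size_rcons A x) => //=.
Qed.

Lemma answers_cat (V A : n.-tuple 'I_q) xs ys :
  answers V A (xs ++ ys) =
  answers V A xs ++ answers V (foldl (@Defs.shift q n) A xs) ys.
Proof. by elim: xs A => //= x xs IH A; rewrite IH. Qed.

Lemma size_answers (V A : n.-tuple 'I_q) xs : size (answers V A xs) = size xs.
Proof. by elim: xs A => //= x xs IH A; rewrite IH. Qed.

Lemma nth_answers (V A : n.-tuple 'I_q) xs i : i < size xs ->
  nth 0 (answers V A xs) i =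
  inner_mod (foldl (@Defs.shift q n) A (take i.+1 xs)) V.
Proof.
elim: xs A i => //= x xs IH A [|i] i_lt /=; first by rewrite take0.
exact: IH.
Qed.

(* Seen from the second half of a window of length [2 ^ k.+1], the first half
   enters through a unitriangular matrix: the only power of two in
   [[2 ^ k, 2 ^ k.+1)] is [2 ^ k]. *)
Lemma answers_inj k (A : n.-tuple 'I_q) (l l' r : seq 'I_q) :
    2 ^ k < n -> 1 < q ->
    size l = 2 ^ k -> size l' = 2 ^ k -> size r = 2 ^ k ->
    answers hard_vector (foldl (@Defs.shift q n) A l) r =
    answers hard_vector (foldl (@Defs.shift q n) A l') r ->
  l = l'.
Proof.
move=> k_lt q_gt1 szl szl' szr eq_ans.
pose x0 := Ordinal q_gt0.
suff eqnth d : d < 2 ^ k ->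
    nth x0 l (2 ^ k - d.+1) = nth x0 l' (2 ^ k - d.+1).
  apply: (@eq_from_nth _ x0) => [|i]; rewrite szl // => i_lt.
  have -> : i = 2 ^ k - (2 ^ k - i.+1).+1 by lia.
  by apply: eqnth; lia.
(* Entries are recovered from last to first: at answer [s], entry [s] of [l] is at distance [2 ^ k]
   from the end and has weight 1. *)
elim/ltn_ind: d => d IH d_lt; set s := 2 ^ k - d.+1.
have s_lt : s < 2 ^ k by rewrite /s; lia.
have := congr1 (nth 0 ^~ s) eq_ans; rewrite !nth_answers ?szr //.
rewrite -!foldl_cat /inner_mod.
have i0P : n.-1 - 2 ^ k < n by lia.
pose i0 := Ordinal i0P.
have tnthE (h : seq 'I_q) i : tnth (foldl (@Defs.shift q n) A h) i =
    nth x0 (A ++ h) (size h + i).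
  by rewrite (tnth_nth x0) val_foldl_shift nth_drop.
have V0 : tnth hard_vector i0 = 1 :> nat.
  rewrite tnth_mktuple /= (_ : n.-1 - _ = 2 ^ k); last by lia.
  by rewrite power_of_two_expn modn_small.
rewrite (bigD1 i0) //= [in RHS](bigD1 i0) //=.
rewrite V0 !muln1.
set S := \sum_(_ | _) _; set S' := \sum_(_ | _) _.
have eqS : S = S'.
  apply: eq_bigr => i i_neq; rewrite !tnthE !nth_cat !size_cat.
  rewrite size_takel ?szr // szl szl' size_tuple.
  case: ltnP => // n_le; set p := _ - n; case: ltnP => // p_lt.
  (* Later entries of [l] agree by induction; earlier ones lie strictly between distances [2 ^ k]
     and [2 ^ k.+1], so they have weight 0. *)
  have [p_gt|p_lt_s|p_eq] := ltngtP s p.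
  - suff -> : nth x0 l p = nth x0 l' p by [].
    have -> : p = 2 ^ k - (2 ^ k - p.+1).+1 by lia.
    by apply: IH; lia.
  - rewrite tnth_mktuple /= (@power_of_twoF k) ?mod0n ?muln0 //.
    by rewrite expnS; lia.
  - case/eqP: i_neq; apply: val_inj => /=; lia.
rewrite eqS => /eqP; rewrite eqn_modDr => /eqP.
rewrite !modn_small // => /val_inj.
rewrite !tnthE !nth_cat !size_cat size_takel ?szr // szl szl' size_tuple /=.
rewrite (_ : _ + _ - n = s); last by lia.
by case: ltnP => [|_]; [lia|rewrite s_lt].
Qed.

End HardVector.

(** * Lower bounds on the transfer, summed over the tree *)

Section InformationTransfer.
Variables (q n w : nat) (q_gt0 : 0 < q) (w_gt0 : 0 < w) (alg : algorithm q w).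
Hypothesis alg_solves : solves q_gt0 (hard_vector n q_gt0) alg.

Let mem_after := memory_after alg (initial_memory alg).

Lemma answers_memory_after pre xs :
  map val (outputs_from alg (mem_after pre) xs) =
  answers (hard_vector n q_gt0)
    (foldl (@Defs.shift q n) (zero_vector n q_gt0) pre) xs.
Proof.
have := alg_solves (pre ++ xs).
rewrite /outputs outputs_from_cat answers_cat map_cat => /eqP.
by rewrite eqseq_cat ?size_map ?size_outputs_from ?size_answers // => /andP[_ /eqP].
Qed.

(* The cells of [transfer], superimposed on the memory preceding [l], suffice
   to simulate the second half [r], whose answers determine [l]. *)
Lemma card_small_transfer k m pre (r : seq 'I_q) :
    2 ^ k < n -> 1 < q -> size r = 2 ^ k ->
  #|[set l : (2 ^ k).-tuple 'I_q |
      #|transfer alg (mem_after pre) l r| <= m]%SET| <= 2 ^ (2 * w * m).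
Proof.
move=> k_lt q_gt1 szr; set mem := mem_after pre; set S := finset _.
pose enc (l : (2 ^ k).-tuple 'I_q) : memory w :=
  [ffun a => if a \in transfer alg mem l r then memory_after alg mem l a
             else mem a].
have enc_outputs l : outputs_from alg (enc l) r =
    outputs_from alg (mem_after (pre ++ l)) r.
  rewrite /mem_after memory_after_cat -/mem_after -/mem.
  apply: eq_on_first_reads => a a_in; rewrite ffunE !inE a_in /=.
  by case: eqP => [->|].
have enc_inj : injective enc.
  move=> l l' eq_enc; apply: val_inj.
  pose A := foldl (@Defs.shift q n) (zero_vector n q_gt0) pre.
  apply: (@answers_inj _ _ q_gt0 k A _ _ r k_lt q_gt1); rewrite ?size_tuple //.
  rewrite -!foldl_cat -!answers_memory_after.
  by rewrite -!enc_outputs eq_enc.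
rewrite -(card_imset _ enc_inj).
apply: leq_trans (card_hamming_ball mem m).
apply: subset_leq_card; apply/fintype.subsetP => _ /finset.imsetP[l + ->].
rewrite !inE; apply: leq_trans; apply: subset_leq_card.
apply/fintype.subsetP => a; rewrite !inE ffunE !inE.
by case: ifP => //; rewrite eqxx.
Qed.

(** By counting, at most half of the [l] have a transfer of size at most [m]; each of the others
    contributes at least [m.+1]. *)
Lemma sum_transfer_ge k pre (r : seq 'I_q) : 2 ^ k < n -> size r = 2 ^ k ->
  2 ^ k * trunc_log 2 q * q ^ (2 ^ k) <=
  4 * w * \sum_(l : (2 ^ k).-tuple 'I_q) #|transfer alg (mem_after pre) l r|.
Proof.
move=> k_lt szr.
have [q_le1|q_gt1] := leqP q 1.
  have -> : trunc_log 2 q = 0 by apply/eqP; rewrite trunc_log_eq0 ltnS q_le1.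
  by rewrite muln0.
set d := trunc_log 2 q.
have d_gt0 : 0 < d by rewrite trunc_log_gt0.
have Ld_gt0 : 0 < 2 ^ k * d by rewrite muln_gt0 expn_gt0.
(* The predecessor gives [2 * w * m < 2 ^ k * d]; the spare bit is the factor 2 in [small2]. *)
pose m := (2 ^ k * d).-1 %/ (2 * w).
have m_ge : 2 ^ k * d <= m.+1 * (2 * w).
  have := @ltn_ceil (2 ^ k * d).-1 (2 * w); rewrite -/m; lia.
have small := card_small_transfer m pre k_lt q_gt1 szr.
set S := finset _ in small.
have small2 : 2 * #|S| <= q ^ (2 ^ k).
  apply: (@leq_trans (2 ^ (2 ^ k * d))).
    apply: leq_trans (_ : 2 ^ (2 * w * m).+1 <= _).
      by rewrite expnS leq_mul2l.
    rewrite leq_exp2l // mulnC.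
    have := leq_trunc_div (2 ^ k * d).-1 (2 * w); rewrite -/m; lia.
  by rewrite mulnC expnM leq_exp2r ?expn_gt0 // trunc_logP.
have cardC : #|~: S| + #|S| = q ^ (2 ^ k).
  by rewrite addnC cardsC card_tuple card_ord.
have sum_ge : #|~: S| * m.+1 <=
    \sum_(l : (2 ^ k).-tuple 'I_q) #|transfer alg (mem_after pre) l r|.
  rewrite -sum_nat_const big_mkcond /=; apply: leq_sum => l _.
  by case: ifP => //; rewrite !inE -ltnNge.
apply: leq_trans (leq_mul (leqnn _) sum_ge).
have -> : 4 * w * (#|~: S| * m.+1) = (m.+1 * (2 * w)) * (2 * #|~: S|) by lia.
by apply: leq_mul => //; lia.
Qed.

(** Induction on the tree, with [pre] general because the right half starts after [pre ++ l]. The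
    constant 4 becomes 8 because the bound at the root is in terms of half the window length. *)
Lemma sum_total_transfer_ge k pre : 2 ^ k <= n ->
  k * 2 ^ k * trunc_log 2 q * q ^ (2 ^ k) <=
  8 * w * \sum_(xs : (2 ^ k).-tuple 'I_q) total_transfer alg k (mem_after pre) xs.
Proof.
elim: k pre => [//|k IH] pre k_le.
have k_lt : 2 ^ k < n by apply: leq_trans k_le; rewrite ltn_exp2l.
have exp2S : 2 ^ k.+1 = 2 ^ k + 2 ^ k by rewrite expnS mul2n addnn.
rewrite (big_cat_tuple _ exp2S) /=.
set d := trunc_log 2 q in IH *; set Q := q ^ (2 ^ k) in IH *.
have cardQ : #|{: (2 ^ k).-tuple 'I_q}| = Q by rewrite card_tuple card_ord.
under eq_bigr => l _ do under eq_bigr => r _ do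
  rewrite take_size_cat ?size_tuple // drop_size_cat ?size_tuple //.
under eq_bigr => l _ do rewrite !big_split /= sum_nat_const cardQ.
rewrite !big_split /= -big_distrr /=.
set SL := \sum_(l : _.-tuple _) _; set SR := \sum_(l : _.-tuple _) _.
set SD := \sum_(l : _.-tuple _) _.
have SL_ge : k * 2 ^ k * d * Q <= 8 * w * SL by apply: IH; lia.
have SR_ge : Q * (k * 2 ^ k * d * Q) <= 8 * w * SR.
  rewrite -cardQ -sum_nat_const /SR big_distrr /=; apply: leq_sum => l _.
  have := IH (pre ++ l) (ltnW k_lt).
  by rewrite /mem_after memory_after_cat cardQ.
have SD_ge : Q * (2 ^ k * d * Q) <= 4 * w * SD.
  (* The transfer bound averages over [l] for each fixed [r], hence the exchange of sums. *)
  rewrite -{1}cardQ -sum_nat_const /SD exchange_big big_distrr /=.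
  apply: leq_sum => r _; apply: sum_transfer_ge => //; exact: size_tuple.
have -> : q ^ (2 ^ k.+1) = Q * Q by rewrite exp2S expnD.
have SL_ge' : Q * (k * 2 ^ k * d * Q) <= Q * (8 * w * SL).
  by rewrite leq_mul2l SL_ge orbT.
rewrite exp2S; nia.
Qed.

Lemma sum_total_cost_ge k : 2 ^ k <= n ->
  k * 2 ^ k * trunc_log 2 q * q ^ (2 ^ k) <=
  8 * w * \sum_(xs : (2 ^ k).-tuple 'I_q) total_cost alg xs.
Proof.
move=> /(sum_total_transfer_ge [::]) /leq_trans; apply.
rewrite leq_mul2l; apply/orP; right; apply: leq_sum => xs _.
exact: leq_trans (leq_addr _ _) (total_transfer_le_cost _ _ _ _).
Qed.

End InformationTransfer.

(** * Real logarithms and expected cost *)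

Import Order.TTheory GRing.Theory Num.Theory.
Local Open Scope ring_scope.

(** With [t = trunc_log 2 m], the logarithm is below [t + 1 <= 2 * t] when [m > 1]; both sides
    vanish when [m = 1]. *)
Lemma log2_le (R : realType) (m : nat) : (0 < m)%N ->
  log2 (m%:R : R) <= (2 * trunc_log 2 m)%:R.
Proof.
move=> m_gt0.
have ln2_gt0 : 0 < ln 2 :> R by rewrite ln_gt0 // ltr1n.
rewrite /log2 ler_pdivrMr // mulr_natl -lnXn ?ltr0n // -natrX.
rewrite ler_ln ?posrE ?ltr0n ?expn_gt0 // ler_nat.
have [->//|m_gt1] : m = 1%N \/ (1 < m)%N by lia.
have t_gt0 : (0 < trunc_log 2 m)%N by rewrite trunc_log_gt0.
apply: leq_trans (ltnW (trunc_log_ltn m (isT : 1 < 2)%N)) _.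
by rewrite leq_exp2l //; lia.
Qed.

Lemma log2_ge0 (R : realType) (m : nat) : (0 < m)%N -> 0 <= log2 (m%:R : R).
Proof. by move=> m_gt0; rewrite divr_ge0 // ln_ge0 // ler1n. Qed.

Lemma uniform_sum1 (R : realType) (T : finType) : (0 < #|T|)%N ->
  \sum_(x : T) [ffun=> #|T|%:R^-1 : R] x = 1.
Proof.
move=> T_gt0; under eq_bigr do rewrite ffunE.
by rewrite sumr_const -[LHS]mulr_natl divff // pnatr_eq0 -lt0n.
Qed.

Lemma uniform_ge0 (R : realType) (T : finType) (x : T) :
  0 <= [ffun=> #|T|%:R^-1 : R] x.
Proof. by rewrite ffunE invr_ge0. Qed.

Lemma expn2_gt0 k : (0 < 2 ^ k)%N.
Proof. by rewrite expn_gt0. Qed.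

Lemma card_tuple_gt0 (q N : nat) : (0 < q)%N -> (0 < #|{: N.-tuple 'I_q}|)%N.
Proof. by move=> q_gt0; rewrite card_tuple card_ord expn_gt0 q_gt0. Qed.

Definition hard_instance (R : realType) (q n : nat) (q_gt0 : (0 < q)%N) :
    instance R q n :=
  @Instance R q n (hard_vector n q_gt0) (2 ^ trunc_log 2 n)
    (expn2_gt0 _) [ffun=> #|{: (2 ^ trunc_log 2 n).-tuple 'I_q}|%:R^-1]
    (@uniform_ge0 R _) (uniform_sum1 R (card_tuple_gt0 _ q_gt0)).

(** The constant 32 is the 8 of the counting bound times a factor 2 for rounding each of the two
    logarithms. *)
Lemma amortised_cost_ge (R : realType) (q n w : nat) (q_gt0 : (0 < q)%N)
    (alg : algorithm q w) : (0 < n)%N -> (0 < w)%N ->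
    solves q_gt0 (hard_vector n q_gt0) alg ->
  32%:R^-1 * (log2 (q%:R : R) / w%:R * log2 (n%:R : R)) <=
  \sum_xs inst_prob (hard_instance R n q_gt0) xs *
    ((total_cost alg xs)%:R / (inst_length (hard_instance R n q_gt0))%:R).
Proof.
move=> n_gt0 w_gt0 alg_solves.
set K := trunc_log 2 n; set d := trunc_log 2 q.
have := sum_total_cost_ge w_gt0 alg_solves (trunc_logP (isT : 1 < 2)%N n_gt0).
rewrite -/K -/d.
under [X in _ -> _ <= X]eq_bigr => xs _ do rewrite ffunE /= mulrA.
rewrite -mulr_suml -mulr_sumr -natr_sum card_tuple card_ord -/K.
set C := (\sum_xs _)%N; rewrite -(ler_nat R) !natrM => cost_ge.
have w_gt0R : 0 < w%:R :> R by rewrite ltr0n.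
have N_gt0 : 0 < (2 ^ K)%:R :> R by rewrite ltr0n expn_gt0.
have Q_gt0 : 0 < (q ^ 2 ^ K)%:R :> R by rewrite ltr0n expn_gt0 q_gt0.
apply: (@le_trans _ _ (K%:R * d%:R / (8 * w%:R))); last first.
  rewrite ler_pdivlMr // [leRHS]mulrC ler_pdivlMr // -[leLHS]mulrA mulrAC.
  rewrite ler_pdivrMr ?mulr_gt0 //; move: cost_ge.
  by rewrite [X in X <= _ -> _](_ : _ = K%:R * d%:R * ((2 ^ K)%:R * (q ^ 2 ^ K)%:R));
    [rewrite [_ * C%:R]mulrC|ring].
have logs_le : log2 (q%:R : R) * log2 (n%:R : R) <= 4 * (d%:R * K%:R).
  have := ler_pM (log2_ge0 R q_gt0) (log2_ge0 R n_gt0) (log2_le R q_gt0)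
    (log2_le R n_gt0).
  by rewrite -/K -/d !natrM; lra.
rewrite ler_pdivlMr ?mulr_gt0 //.
have -> : 32%:R^-1 * (log2 q%:R / w%:R * log2 n%:R) * (8 * w%:R) =
   4^-1 * (log2 q%:R * log2 n%:R) :> R by field; rewrite gt_eqF.
lra.
Qed.

Theorem theorem1 (R : realType) :
  exists c : R, 0 < c /\
    forall (q n w : nat) (q_gt0 : (0 < q)%N), (0 < n)%N -> (0 < w)%N ->
      exists I : instance R q n,
        forall (d : measure_display) (T : measurableType d)
          (P : probability T R) (alg : random_algorithm T q w),
          solves_surely q_gt0 (inst_vector I) alg ->
          measurable_cost R alg ->
          ((c * (log2 (q%:R : R) / w%:R * log2 (n%:R : R)))%:E
             <= expected_amortised_cost P I alg)%E.
Proof.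
exists 32%:R^-1; split=> // q n w q_gt0 n_gt0 w_gt0.
exists (hard_instance R n q_gt0) => d T P alg alg_solves alg_measurable.
(* The instance does not depend on the algorithm, so the bound holds for every outcome [t] of the
   coins and can be integrated. *)
have cost_ge t := amortised_cost_ge R n_gt0 w_gt0 (alg_solves t).
rewrite /expected_amortised_cost; set b := 32%:R^-1 * _ in cost_ge *.
have b_ge0 : 0 <= b.
  apply: mulr_ge0; rewrite ?invr_ge0 //.
  by apply: mulr_ge0; [apply: divr_ge0 => //|]; apply: log2_ge0.
have <- : (\int[P]_(t in [set: T]%classic) b%:E = b%:E)%E.
  by rewrite integral_cst // [X in (_ * X)%E]probability_setT mule1.
apply: ge0_le_integral => //.
  apply/measurable_EFinP; apply: measurable_sum => xs.
  by apply: measurable_funM => //; apply: measurable_funM.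
by move=> t _; rewrite lee_fin.
Qed.
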